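(* For $0<q<1$, $$\left(\sum_{n=-\infty}^\infty q^{n^2}\right)\left(\sum_{n=0}^\infty q^{n(n+1)/2}\right)=\sum_{n=0}^\infty\sum_{j=-n}^n(-1)^{n+j}(1+q^{2n+1})q^{2n^2+n-2j^2}.$$
   Context: The double sum is read as an outer sum over $n$ of the finite inner sums over $j$. *)

(* Defs.v *)
From HB Require Import structures.
From mathcomp Require Import all_boot all_order all_algebra.
From mathcomp Require Import all_classical all_reals all_analysis.

Set Implicit Arguments.
Unset Strict Implicit.
Unset Printing Implicit Defensive.

Import Order.TTheory GRing.Theory Num.Theory.
Import numFieldNormedType.Exports.

Local Open Scope classical_set_scope.
Local Open Scope ring_scope.

(* A sum over all integers converges when its two tails, over n >= 0 and over
   n <= -1, converge independently of each other. Since limn takes a default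
   value on divergent sequences, bilateral_sum a is only meaningful together
   with bilateral_cvg a. *)
Definition bilateral_cvg (R : realType) (a : int -> R) : Prop :=
  cvgn (series (fun n : nat => a n%:Z)) /\
  cvgn (series (fun n : nat => a (- (n.+1)%:Z))).

Definition bilateral_sum (R : realType) (a : int -> R) : R :=
  limn (series (fun n : nat => a n%:Z)) +
  limn (series (fun n : nat => a (- (n.+1)%:Z))).

(* The exponent 2n^2+n-2j^2 is computed in int; it is nonnegative for |j| <= n. *)
Definition inner_sum (R : realType) (q : R) (n : nat) : R :=
  \sum_(j \in `[- n%:Z, n%:Z])
    (-1) ^ (n%:Z + j) * (1 + q ^+ (2 * n + 1))
      * q ^ (2 * n%:Z ^+ 2 + n%:Z - 2 * j ^+ 2).

(* Main.v *)
Require Import Defs.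
From HB Require Import structures.
From mathcomp Require Import all_boot all_order all_algebra.
From mathcomp Require Import all_classical all_reals all_analysis.
From mathcomp Require Import ring lra zify.

Set Implicit Arguments.
Unset Strict Implicit.
Unset Printing Implicit Defensive.

Import Order.TTheory GRing.Theory Num.Theory.
Import numFieldNormedType.Exports.

Local Open Scope classical_set_scope.
Local Open Scope ring_scope.

(** Write q = t^2 and (a; p) for the infinite product of the 1 - a p^k, k >= 0.

    In the coordinates a = n - j, b = n + j the exponent 2n^2 + n - 2j^2 becomes
    2ab + (a + b)/2, and the double sum becomes a sum of
      (-1)^b (t^(a+b+4ab) + t^(3a+3b+4ab+2))
    over the pairs a, b >= 0 of the same parity. Pairs of opposite parity may be
    added: swapping a and b shows that they cancel on each antidiagonal
    ([hecke_odd_diagonal]). Summing over b first leaves geometric series, whence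
    the Lambert series
      L = sum over all integers j of t^j / (1 + t^(4j+1))
    ([inner_sum_lambert]; the change of order of summation is justified by
    Tannery's theorem, [hecke_triangle_cvg]).

    Kronecker's formula ([kronecker]) evaluates L as a quotient of theta products,
      L (q; q^2) = (-q; q^2)^2 (q^2; q^2)^2     ([lambert_product]),
    while Jacobi's triple product ([jacobi_triple]) gives the two factors on the
    left-hand side of the theorem,
      phi = (-q; q^2)^2 (q^2; q^2),   psi = (-q; q)^2 (q; q)
    ([phi_product], [psi_product]). The two sides then agree by Euler's identity
    (q; q^2) (-q; q) = 1, multiplied by (q; q).

    Kronecker's formula and the triple product are both limits of identities
    between finite sums over [-n, n] ([kronecker_finite], [jacobi_triple_finite]),
    which follow by induction from a recurrence in the length of the sum; the
    common passage to the limit is [convolution_cvg]. *)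

(** * Finite q-products *)

(** The q-Pochhammer symbol (a; p)_n. *)
Definition qpoch (R : pzRingType) (a p : R) (n : nat) : R :=
  \prod_(k < n) (1 - a * p ^+ k).

Lemma qpoch0 (R : pzRingType) (a p : R) : qpoch a p 0 = 1.
Proof. by rewrite /qpoch big_ord0. Qed.

Lemma qpochSr (R : pzRingType) (a p : R) n :
  qpoch a p n.+1 = qpoch a p n * (1 - a * p ^+ n).
Proof. by rewrite /qpoch big_ord_recr. Qed.

Lemma qpochSl (R : comPzRingType) (a p : R) n :
  qpoch a p n.+1 = (1 - a) * qpoch (a * p) p n.
Proof.
rewrite /qpoch big_ord_recl /= expr0 mulr1; congr (_ * _).
by apply: eq_bigr => k _; rewrite /bump /= exprS mulrA.
Qed.

Lemma qpochD (R : comPzRingType) (a p : R) m n :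
  qpoch a p (m + n) = qpoch a p m * qpoch (a * p ^+ m) p n.
Proof.
rewrite /qpoch big_split_ord /=; congr (_ * _).
by apply: eq_bigr => k _; rewrite exprD mulrA.
Qed.

Lemma qpoch_pp_neq0 (F : fieldType) (p : F) n :
  (forall k, p ^+ k.+1 != 1) -> qpoch p p n != 0.
Proof.
move=> p1; apply/prodf_neq0 => k _; rewrite subr_eq0 eq_sym -exprS; exact: p1.
Qed.

Lemma qpoch_oppM (R : comPzRingType) (a p : R) n :
  qpoch a p n * qpoch (- a) p n = qpoch (a ^+ 2) (p ^+ 2) n.
Proof.
rewrite /qpoch -big_split; apply: eq_bigr => k _ /=.
by rewrite -exprM mulnC exprM; ring.
Qed.

Lemma qpoch_double (R : comPzRingType) (a p : R) n :
  qpoch a p (n + n) = qpoch a (p ^+ 2) n * qpoch (a * p) (p ^+ 2) n.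
Proof.
elim: n => [|n IHn]; first by rewrite !qpoch0 mulr1.
rewrite addSn addnS !qpochSr IHn (exprSr p (n + n)) addnn -mul2n exprM.
by ring.
Qed.

(** Reversing the product turns the factors 1 - a p^(-k), 1 <= k <= n, into
    1 - p^k / a. This is how one-sided finite products become products that are
    symmetric about the centre of a sum over [-n, n]. *)
Lemma qpoch_reflect (R : fieldType) (a p : R) n : a != 0 -> p != 0 ->
  qpoch (a / p ^+ n) p n
  = (- a) ^+ n / p ^+ 'C(n.+1, 2) * qpoch (p / a) p n.
Proof.
move=> a0 p0; elim: n => [|n IHn].
  by rewrite !qpoch0 !expr0 divr1 mulr1.
rewrite qpochSl qpochSr.
have -> : a / p ^+ n.+1 * p = a / p ^+ n.
  by rewrite exprS; field; rewrite expf_neq0 // p0.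
rewrite IHn (binS n.+1 1) bin1 exprD [(- a) ^+ n.+1]exprS ![p ^+ n.+1]exprS.
by field; rewrite a0 p0 !expf_neq0.
Qed.

(** * Finite forms of the theta identities *)

(** The finite q-binomial theorem, with the quotients (p;p)_N / ((p;p)_i (p;p)_(N-i))
    in place of Gaussian binomials. Both sides, multiplied by 1 - p^(N+1) at
    rank N+1, satisfy S_(N+1)(w) = (1 + w) S_N(p w). *)
Lemma qpoch_sum (R : fieldType) (p w : R) N : (forall k, p ^+ k.+1 != 1) ->
  \sum_(i < N.+1) p ^+ 'C(i, 2) * w ^+ i
    / (qpoch p p i * qpoch p p (N - i))
  = qpoch (- w) p N / qpoch p p N.
Proof.
move=> p1.
have E0 n : qpoch p p n != 0 by exact: qpoch_pp_neq0.
elim: N w => [|N IHN] w.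
  by rewrite big_ord1 /= !qpoch0 !expr0 !mulr1.
have pN : 1 - p ^+ N.+1 != 0 by rewrite subr_eq0 eq_sym p1.
apply: (mulfI pN).
have -> : (1 - p ^+ N.+1) * (qpoch (- w) p N.+1 / qpoch p p N.+1)
   = (1 + w) * (qpoch (- (w * p)) p N / qpoch p p N).
  rewrite qpochSl [qpoch p p N.+1]qpochSr -exprS mulNr.
  by field; rewrite pN E0.
rewrite -IHN mulr_sumr.
(* 1 - p^(N+1) = (1 - p^i) + p^i (1 - p^(N+1-i)): each part cancels one factor
   of the denominator, which shifts i or N. *)
transitivity (\sum_(i < N.+2) p ^+ 'C(i, 2) * w ^+ i * (1 - p ^+ i)
      / (qpoch p p i * qpoch p p (N.+1 - i))
    + \sum_(i < N.+2) p ^+ 'C(i, 2) * w ^+ i * p ^+ i * (1 - p ^+ (N.+1 - i))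
      / (qpoch p p i * qpoch p p (N.+1 - i))).
  rewrite -big_split /=; apply: eq_bigr => i _.
  have -> : 1 - p ^+ N.+1 = (1 - p ^+ i) + p ^+ i * (1 - p ^+ (N.+1 - i)).
    by rewrite mulrBr mulr1 -exprD subnKC ?leq_ord // addrA subrK.
  by ring.
rewrite mulrDl mul1r addrC; congr (_ + _).
  rewrite big_ord_recr /= subnn subrr mulr0 mul0r addr0.
  apply: eq_bigr => i _; rewrite subSn ?leq_ord //.
  rewrite [qpoch p p (_ - _).+1]qpochSr exprMn -exprS.
  have := p1 (N - i)%N; rewrite -subr_eq0 -oppr_eq0 opprB => h.
  by field; rewrite h !E0.
rewrite big_ord_recl /= expr0 subrr mulr0 mul0r add0r mulr_sumr.
apply: eq_bigr => i _; rewrite /bump /= add1n subSS.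
rewrite [qpoch p p i.+1]qpochSr -exprS (binS i 1) bin1 exprD exprMn [w ^+ i.+1]exprS.
have := p1 i; rewrite -subr_eq0 -oppr_eq0 opprB => h.
by field; rewrite h !E0.
Qed.

(** The partial fraction expansion in z of (xz; p)_N / (z; p)_(N+1). Both sides
    satisfy
      z (1 - p^(N+1)) S_(N+1)(z) = (1 - x z p^N) S_N(z) - (1 - x z) S_N(z p),
    which allows an induction on N for all z at once. *)
Lemma kronecker_sum (R : fieldType) (p x z : R) N :
    p != 0 -> x != 0 -> z != 0 ->
    (forall k, p ^+ k.+1 != 1) -> (forall k, z * p ^+ k != 1) ->
  \sum_(i < N.+1) x ^+ i / (1 - z * p ^+ i)
    * (qpoch x p (N - i) / qpoch p p (N - i))
    * (qpoch (p / x) p i / qpoch p p i)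
  = qpoch (x * z) p N / qpoch z p N.+1.
Proof.
move=> p0 x0 z0 p1; elim: N z z0 => [|N IHN] z z0 z1.
  rewrite big_ord1 qpochSr !qpoch0 !expr0.
  by rewrite !(divr1, mulr1, mul1r).
have E0 n : qpoch p p n != 0 by exact: qpoch_pp_neq0.
have pk k : 1 - p ^+ k.+1 != 0 by rewrite subr_eq0 eq_sym p1.
have zk k : 1 - z * p ^+ k != 0 by rewrite subr_eq0 eq_sym z1.
have Z0 n : qpoch z p n != 0 by apply/prodf_neq0 => k _; exact: zk.
have Zp0 n : qpoch (z * p) p n != 0.
  by apply/prodf_neq0 => k _; rewrite -mulrA -exprS; exact: zk.
have zp k : z * p * p ^+ k != 1 by rewrite -mulrA -exprS; exact: z1.
have zp0 : z * p != 0 by rewrite mulf_neq0.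
apply: (mulfI (pk N)).
transitivity (z^-1 * ((1 - x * z * p ^+ N) * (qpoch (x * z) p N / qpoch z p N.+1)
     - (1 - x * z) * (qpoch (x * (z * p)) p N / qpoch (z * p) p N.+1))); last first.
  have e1 : qpoch (x * z) p N * (1 - x * z * p ^+ N)
     = (1 - x * z) * qpoch (x * (z * p)) p N.
    by rewrite -qpochSr qpochSl mulrA.
  have e2 : (1 - z) * qpoch (z * p) p N.+1 = qpoch z p N.+1 * (1 - z * p ^+ N.+1).
    by rewrite -qpochSl qpochSr.
  have z1' : 1 - z != 0 by have := zk 0%N; rewrite expr0 mulr1.
  have -> : qpoch (z * p) p N.+1 = qpoch z p N.+1 * (1 - z * p ^+ N.+1) / (1 - z).
    by rewrite -e2; field.
  rewrite [qpoch z p N.+2]qpochSr [qpoch (x * z) p N.+1]qpochSr.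
  rewrite (mulrA (1 - x * z * p ^+ N)) (mulrC (1 - x * z * p ^+ N)) e1.
  have [h1 h2] := (zk N.+1, Z0 N.+1).
  by field; rewrite h1 h2 z0 z1'.
(* It remains to derive the same recurrence for the sum, by splitting
   1 - p^(N+1) = (1 - p^i) + p^i (1 - p^(N+1-i)); the partial fractions
   (x - p^(i+1)) / (1 - z p^(i+1)) and (p^i - x p^N) / (1 - z p^i) then
   contribute polynomial parts 1/z and - 1/z, which cancel. *)
rewrite -(IHN _ z0 z1) -(IHN _ zp0 zp) !mulr_sumr -sumrB mulr_sumr.
transitivity (\sum_(i < N.+2) x ^+ i / (1 - z * p ^+ i) * (1 - p ^+ i)
    * (qpoch x p (N.+1 - i) / qpoch p p (N.+1 - i))
    * (qpoch (p / x) p i / qpoch p p i)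
  + \sum_(i < N.+2) x ^+ i / (1 - z * p ^+ i) * (p ^+ i * (1 - p ^+ (N.+1 - i)))
    * (qpoch x p (N.+1 - i) / qpoch p p (N.+1 - i))
    * (qpoch (p / x) p i / qpoch p p i)).
  rewrite -big_split /=; apply: eq_bigr => i _.
  have -> : 1 - p ^+ N.+1 = (1 - p ^+ i) + p ^+ i * (1 - p ^+ (N.+1 - i)).
    by rewrite mulrBr mulr1 -exprD subnKC ?leq_ord // addrA subrK.
  by ring.
rewrite big_ord_recl /= expr0 subrr mulr0 !mul0r add0r.
rewrite [X in _ + X]big_ord_recr /= subnn subrr !(mulr0, mul0r) addr0.
rewrite -big_split /=; apply: eq_bigr => i _.
rewrite /bump /= add1n subSS subSn ?leq_ord //.
rewrite [qpoch p p i.+1]qpochSr -exprS [qpoch _ p (_ - _).+1]qpochSr.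
rewrite [qpoch p p (_ - _).+1]qpochSr -exprS [qpoch (p / x) p i.+1]qpochSr.
have -> : p ^+ N = p ^+ i * p ^+ (N - i) by rewrite -exprD subnKC ?leq_ord.
have [h1 h2] := (pk i, pk (N - i)%N).
have [h3 h4] := (zk i, zk i.+1).
have [h5 h6] := (E0 i, E0 (N - i)%N).
move: h1 h2 h3 h4 h5 h6.
rewrite ![_ ^+ _.+1]exprS.
move: (p ^+ i) (p ^+ (N - i)) (qpoch x p (N - i)) (qpoch p p (N - i))
  (qpoch (p / x) p i) (qpoch p p i) (x ^+ i) => P Q A B C D X.
rewrite -!mulrA.
move=> h1 h2 h3 h4 h5 h6.
by field; rewrite -?mulrA h1 h2 h3 h4 h5 h6 z0 x0.
Qed.

Lemma expfz_sub (F : fieldType) (x : F) (m n : nat) : x != 0 ->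
  x ^ (m%:Z - n%:Z) = x ^+ m / x ^+ n.
Proof. by move=> x0; rewrite expfzDr // exprnN. Qed.

Lemma bin2_double i : (2 * 'C(i, 2) + i = i ^ 2)%N.
Proof. by elim: i => // i IHi; rewrite binS bin1; lia. Qed.

(** The q-binomial theorem in base p^2 with N = 2n, centred: the substitution
    w = z p / p^(2n) turns the exponents into squares of i - n. *)
Lemma jacobi_triple_finite (F : fieldType) (p z : F) n :
    p != 0 -> z != 0 -> (forall k, (p ^+ 2) ^+ k.+1 != 1) ->
  \sum_(i < (n + n).+1) p ^ ((i%:Z - n%:Z) ^+ 2) * z ^ (i%:Z - n%:Z)
    * (qpoch (p ^+ 2) (p ^+ 2) (n + n - i))^-1 * (qpoch (p ^+ 2) (p ^+ 2) i)^-1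
  = qpoch (- (z * p)) (p ^+ 2) n * qpoch (- (p / z)) (p ^+ 2) n
    / qpoch (p ^+ 2) (p ^+ 2) (n + n).
Proof.
move=> p0 z0 P1; set P := p ^+ 2.
have P0 : P != 0 by rewrite expf_neq0.
have zp0 : z * p != 0 by rewrite mulf_neq0.
have := qpoch_sum (z * p / P ^+ n) (n + n) P1.
rewrite -mulNr qpochD divfK ?expf_neq0 // qpoch_reflect ?oppr_eq0 // opprK.
have -> : P / - (z * p) = - (p / z) by rewrite /P; field; rewrite ?oppr_eq0 ?p0 ?z0 ?zp0.
set c := (z * p) ^+ n / _.
have c0 : c != 0 by rewrite mulf_neq0 ?invr_eq0 ?expf_neq0.
move=> e; apply: (mulfI c0).
transitivity (c * qpoch (- (p / z)) P n * qpoch (- (z * p)) P n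
    / qpoch P P (n + n)); last by ring.
rewrite -e mulr_sumr; apply: eq_bigr => i _.
rewrite expfz_sub //.
have -> : (i%:Z - n%:Z) ^+ 2 = (i ^ 2 + n ^ 2)%N%:Z - (2 * n * i)%N%:Z.
  rewrite !PoszD !PoszM; ring.
rewrite expfz_sub // -!bin2_double exprD /c binS bin1 !exprD !exprMn exprVn.
have -> : p ^+ (2 * n * i) = (p ^+ n * p ^+ n) ^+ i.
  by rewrite -exprD -exprM mul2n -addnn.
have E0 m : qpoch P P m != 0 by exact: qpoch_pp_neq0.
have pn m : p ^+ m != 0 by rewrite expf_neq0.
have zn : z ^+ n != 0 by rewrite expf_neq0.
have pni : (p ^+ n * p ^+ n) ^+ i != 0 by rewrite expf_neq0 // mulf_neq0.
move: (E0 i) (E0 (n + n - i)%N) (pn n) (pn 'C(n, 2)) zn pni; rewrite -/P expr0.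
move: (qpoch P P i) (qpoch P P (n + n - i)) (p ^+ n) (p ^+ 'C(n, 2)) (z ^+ n).
move=> a b c' d e' h1 h2 h3 h4 h5; move: ((c' * c') ^+ i) => m h6.
by field; rewrite h1 h2 h3 h4 h5 h6.
Qed.

(** The same centring of the partial fraction expansion, by z = y / p^n. *)
Lemma kronecker_finite (F : fieldType) (p x y : F) n :
    p != 0 -> x != 0 -> y != 0 -> (forall k, p ^+ k.+1 != 1) ->
    (forall j : int, y * p ^ j != 1) ->
  \sum_(i < (n + n).+1) x ^ (i%:Z - n%:Z) / (1 - y * p ^ (i%:Z - n%:Z))
    * (qpoch x p (n + n - i) / qpoch p p (n + n - i))
    * (qpoch (p / x) p i / qpoch p p i)
  = qpoch (x * y) p n * qpoch (p / (x * y)) p n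
    / (qpoch y p n.+1 * qpoch (p / y) p n).
Proof.
move=> p0 x0 y0 p1 yp.
have z0 : y / p ^+ n != 0 by rewrite mulf_neq0 ?invr_eq0 ?expf_neq0.
have zE (k : nat) : y / p ^+ n * p ^+ k = y * p ^ (k%:Z - n%:Z).
  by rewrite expfz_sub //; ring.
have zp k : y / p ^+ n * p ^+ k != 1 by rewrite zE; exact: yp.
have xn : x ^+ n != 0 by rewrite expf_neq0.
apply: (mulfI xn).
have := kronecker_sum (n + n) p0 x0 z0 p1 zp.
have -> : x * (y / p ^+ n) = x * y / p ^+ n by rewrite mulrA.
have -> : qpoch (y / p ^+ n) p (n + n).+1
    = qpoch (y / p ^+ n) p n * qpoch (y / p ^+ n * p ^+ n) p n.+1.
  by rewrite -addnS qpochD.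
rewrite qpochD !divfK ?expf_neq0 // !qpoch_reflect ?mulf_neq0 //.
have yk k : 1 - y * p ^+ k != 0 by rewrite subr_eq0 eq_sym; exact: (yp k).
have Y0 : qpoch y p n.+1 != 0 by apply/prodf_neq0.
have Y1 : qpoch (p / y) p n != 0.
  apply/prodf_neq0 => k _; rewrite subr_eq0 eq_sym.
  apply: contraNneq (yp (- (k.+1)%:Z)) => h.
  rewrite -exprnN -[X in y * X]mulr1 -[X in y * (_ * X)]h exprS.
  by apply/eqP; field; rewrite p0 y0 expf_neq0.
rewrite -mulrN exprMn => e; rewrite mulr_sumr.
transitivity (\sum_(i < (n + n).+1)
   x ^+ i / (1 - y / p ^+ n * p ^+ i) *
   (qpoch x p (n + n - i) / qpoch p p (n + n - i)) *
   (qpoch (p / x) p i / qpoch p p i)).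
  apply: eq_bigr => i _; rewrite zE expfz_sub // !mulrA; congr (_ / _ * _ / _ * _ / _).
  by rewrite mulrAC divff // mul1r.
rewrite e.
have yn : (- y) ^+ n != 0 by rewrite expf_neq0 // oppr_eq0.
have pc : p ^+ 'C(n.+1, 2) != 0 by rewrite expf_neq0.
by field; rewrite Y0 Y1 yn pc.
Qed.

(** * Infinite q-products *)

Lemma qpoch_le_exp (R : realType) (c p : R) n : 0 <= c -> 0 < p < 1 ->
  qpoch (- c) p n <= expR (c / (1 - p)).
Proof.
move=> c0 /andP[p0 p1].
apply: (@le_trans _ _ (expR (\sum_(k < n) c * p ^+ k))).
  rewrite expR_sum; apply: ler_prod => k _.
  rewrite mulNr opprK expR_ge1Dx andbT addr_ge0 // mulr_ge0 // exprn_ge0 //.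
  exact: ltW.
rewrite ler_expR -(big_mkord xpredT (fun k => c * p ^+ k)).
by apply: geometric_le_lim => //; rewrite ger0_norm // ltW.
Qed.

(** The factors lie on one side of 1 according to the sign of a, so the products
    are monotone; comparison with an exponential keeps them bounded, and away
    from 0 when 0 <= a < 1. *)
Lemma qpoch_cvg (R : realType) (a p : R) : a < 1 -> 0 < p < 1 ->
  exists2 l : R, 0 < l & qpoch a p @ \oo --> l.
Proof.
move=> a1 p01; have /andP[p0 p1] := p01.
have pk k : 0 <= p ^+ k <= 1 by rewrite exprn_ge0 ?exprn_ile1 // ltW.
have Q0 b n : b <= 1 -> 0 <= qpoch b p n.
  by move=> b1; apply: prodr_ge0 => k _; have := pk k; nra.
have [a0|a0] := lerP 0 a.
  (* c is chosen so that (1 + c u) (1 - a u) >= 1 for 0 <= u <= 1. *)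
  pose c := a / (1 - a).
  have c0 : 0 <= c by rewrite divr_ge0 // subr_ge0 ltW.
  pose m := (expR (c / (1 - p)))^-1.
  have m0 : 0 < m by rewrite invr_gt0 expR_gt0.
  have lb n : m <= qpoch a p n.
    have h : 1 <= qpoch (- c) p n * qpoch a p n.
      rewrite /qpoch -big_split /=.
      elim/big_ind: _ => // [x y x1 y1|k _]; first by nra.
      have ck : c * (1 - a) = a by rewrite /c divfK // gt_eqF // subr_gt0.
      have /andP[k0 k1] := pk k.
      rewrite mulNr opprK mulrDl mul1r.
      have -> : c * p ^+ k * (1 - a * p ^+ k)
        = c * (1 - a) * p ^+ k + c * a * (p ^+ k * (1 - p ^+ k)) by ring.
      rewrite ck.
      have : 0 <= c * a * (p ^+ k * (1 - p ^+ k)).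
        by apply: mulr_ge0; [exact: mulr_ge0 | apply: mulr_ge0; rewrite ?subr_ge0].
      lra.
    have qc0 : 0 < qpoch (- c) p n.
      by apply: prodr_gt0 => k _; rewrite mulNr opprK ltr_wpDr // mulr_ge0 // (andP (pk k)).1.
    apply: (@le_trans _ _ (qpoch (- c) p n)^-1).
      by rewrite lef_pV2 ?posrE ?expR_gt0 // qpoch_le_exp.
    by rewrite -[leLHS]mul1r ler_pdivrMr // mulrC.
  have Qd : {homo qpoch a p : m n / (m <= n)%N >-> n <= m}.
    apply/nonincreasing_seqP => n; rewrite qpochSr.
    by apply: ler_piMr; [apply: Q0; exact: ltW | have := pk n; nra].
  have cv : cvgn (qpoch a p).
    by apply: nonincreasing_is_cvgn => //; exists m => _ [n _ <-].
  exists (limn (qpoch a p)) => //.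
  by apply: (lt_le_trans m0); apply: limr_ge => //; exact: nearW.
have Qi : {homo qpoch a p : m n / (m <= n)%N >-> m <= n}.
  apply/nondecreasing_seqP => n; rewrite qpochSr.
  by apply: ler_peMr; [apply: Q0; exact: ltW | have := pk n; nra].
have cv : cvgn (qpoch a p).
  apply: nondecreasing_is_cvgn => //; exists (expR (- a / (1 - p))) => _ [n _ <-].
  by rewrite -{1}[a]opprK qpoch_le_exp // oppr_ge0 ltW.
exists (limn (qpoch a p)) => //.
apply: (lt_le_trans ltr01); apply: limr_ge => //; apply: nearW => n.
by rewrite -(qpoch0 a p) Qi.
Qed.

Definition qinf (R : realType) (a p : R) : R := limn (qpoch a p).

Lemma cvg_qpoch (R : realType) (a p : R) : a < 1 -> 0 < p < 1 ->
  qpoch a p @ \oo --> qinf a p.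
Proof. by move=> a1 p01; have [l _ h] := qpoch_cvg a1 p01; apply: cvgP h. Qed.

Lemma qinf_gt0 (R : realType) (a p : R) : a < 1 -> 0 < p < 1 -> 0 < qinf a p.
Proof.
by move=> a1 p01; have [l l0 h] := qpoch_cvg a1 p01; rewrite /qinf (cvg_lim _ h).
Qed.

Lemma cvg_double : (fun n => (n + n)%N) @ \oo --> \oo.
Proof.
under [X in X @ _ --> _]funext => n do rewrite addnn -mul2n.
exact: cvg_mulnl.
Qed.

Lemma qinf_oppM (R : realType) (a p : R) : -1 < a < 1 -> 0 < p < 1 ->
  qinf a p * qinf (- a) p = qinf (a ^+ 2) (p ^+ 2).
Proof.
move=> /andP[a0 a1] p01; have /andP[p0 p1] := p01.
have c1 := cvg_qpoch a1 p01.
have c2 : qpoch (- a) p @ \oo --> qinf (- a) p by apply: cvg_qpoch => //; lra.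
rewrite [RHS](@cvg_lim _ _ _ _ _ _ (qinf a p * qinf (- a) p)) //.
under eq_cvg do rewrite -qpoch_oppM.
exact: cvgM.
Qed.

Lemma qinf_double (R : realType) (a p : R) : a < 1 -> a * p < 1 -> 0 < p < 1 ->
  qinf a p = qinf a (p ^+ 2) * qinf (a * p) (p ^+ 2).
Proof.
move=> a1 ap1 p01; have /andP[p0 p1] := p01.
have p2 : 0 < p ^+ 2 < 1 by apply/andP; split; nra.
have c1 := cvg_comp _ _ cvg_double (cvg_qpoch a1 p01).
rewrite -[LHS](cvg_lim _ c1) //; apply: cvg_lim => //=.
under eq_cvg do rewrite /= qpoch_double.
by apply: cvgM; exact: cvg_qpoch.
Qed.

(** * Limits of finite sums of growing length *)

Lemma cvg_ord_sum (R : realType) (f : nat -> nat -> R) (h : nat -> R) J :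
  (forall j, f^~ j @ \oo --> h j) ->
  (fun n => \sum_(j < J) f n j) @ \oo --> \sum_(j < J) h j.
Proof.
move=> fh; elim: J => [|J IHJ].
  by under eq_cvg do rewrite big_ord0; rewrite big_ord0; exact: cvg_cst.
under eq_cvg do rewrite big_ord_recr /=.
by rewrite big_ord_recr /=; exact: cvgD.
Qed.

(** Tannery's theorem with a geometric majorant: dominated convergence for sums
    whose number of terms u n grows with n. *)
Lemma tannery (R : realType) (f : nat -> nat -> R) (h : nat -> R) (C r : R)
    (u : nat -> nat) : 0 < r < 1 -> (forall n, (n <= u n)%N) ->
    (forall n j, (j < u n)%N -> `|f n j| <= C * r ^+ j) ->
    (forall j, f^~ j @ \oo --> h j) ->
  cvgn (series h) /\
  (fun n => \sum_(j < u n) f n j) @ \oo --> limn (series h).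
Proof.
move=> /andP[r0 r1] un fC fh.
have hC j : `|h j| <= C * r ^+ j.
  have fj : (fun n => `|f n j|) @ \oo --> `|h j| by exact: cvg_norm.
  rewrite -(cvg_lim _ fj) //; apply: limr_le; first exact: cvgP fj.
  near=> n; apply: fC; apply: leq_trans (un n).
  by near: n; exact: nbhs_infty_gt.
have gcv : cvgn (series (geometric C r)).
  by apply: is_cvg_geometric_series; rewrite ger0_norm // ltW.
have C0 : 0 <= C by have := hC 0; rewrite expr0 mulr1; apply: le_trans.
have hcv : cvgn (series h).
  apply: normed_cvg; apply: series_le_cvg gcv => //= n.
  by rewrite mulr_ge0 // exprn_ge0 // ltW.
split=> //.
have tail (g : nat -> R) J K : (forall j, (J <= j < J + K)%N -> `|g j| <= C * r ^+ j) ->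
    `|\sum_(j < J + K) g j - \sum_(j < J) g j| <= C * r ^+ J / (1 - r).
  move=> gC; rewrite big_split_ord /= addrAC subrr add0r.
  apply: (le_trans (ler_norm_sum _ _ _)).
  apply: (@le_trans _ _ (\sum_(0 <= i < K) (C * r ^+ J) * r ^+ i)).
    rewrite big_mkord; apply: ler_sum => i _; rewrite -mulrA -exprD gC //.
    by rewrite leq_addr ltn_add2l ltn_ord.
  apply: geometric_le_lim => //; last by rewrite ger0_norm // ltW.
  by rewrite mulr_ge0 // exprn_ge0 // ltW.
have t0 : (fun J => C * r ^+ J / (1 - r)) @ \oo --> 0.
  rewrite -(mul0r (1 - r)^-1); apply: cvgM; last exact: cvg_cst.
  by apply: cvg_geometric; rewrite ger0_norm // ltW.
apply/cvgrPdist_lt => e e0.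
have e4 : 0 < e / 4 by rewrite divr_gt0.
(* Beyond J, both the partial sums and the limit series are within e / 4 of
   their first J terms. *)
have [J _ HJ] : \forall J \near \oo, C * r ^+ J / (1 - r) < e / 4.
  have /cvgrPdist_lt/(_ _ e4) := t0; apply: filterS => J /=.
  by rewrite sub0r normrN; apply: le_lt_trans; exact: ler_norm.
have {}HJ := HJ J (leqnn J).
have hS : `|limn (series h) - \sum_(j < J) h j| <= e / 4.
  have sJ : (fun n => `|series h n - \sum_(j < J) h j|) @ \oo
      --> `|limn (series h) - \sum_(j < J) h j|.
    by apply: cvg_norm; apply: cvgB => //; exact: cvg_cst.
  rewrite -(cvg_lim _ sJ) //; apply: limr_le; first exact: cvgP sJ.
  near=> n; rewrite /series /= big_mkord.
  have Jn : (J <= n)%N by near: n; exact: nbhs_infty_ge.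
  by rewrite -(subnKC Jn); apply: le_trans (ltW HJ); apply: tail => j _.
have := @cvg_ord_sum _ f h J fh => /cvgrPdist_lt/(_ _ e4) fJ.
near=> n.
have Jn : (J <= u n)%N by apply: leq_trans (un n); near: n; exact: nbhs_infty_ge.
have h1 : `|\sum_(j < u n) f n j - \sum_(j < J) f n j| <= e / 4.
  rewrite -(subnKC Jn); apply: le_trans (ltW HJ); apply: tail => j /andP[_].
  by rewrite subnKC // => jn; exact: fC.
have h2 : `|\sum_(j < J) h j - \sum_(j < J) f n j| < e / 4 by near: n.
move: hS h1 h2.
move: (limn _) (\sum_(j < J) h j) (\sum_(j < J) f n j) (\sum_(j < u n) f n j).
move=> a b c d.
rewrite !ler_norml !ltr_norml => /andP[? ?] /andP[? ?] /andP[? ?].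
by apply/andP; split; lra.
Unshelve. all: by end_near.
Qed.

Lemma central_sum_split (R : nmodType) (F : nat -> R) n :
  \sum_(i < (n + n).+1) F i
  = \sum_(j < n.+1) F (n + j)%N + \sum_(j < n) F (n - j.+1)%N.
Proof.
rewrite -addnS big_split_ord /= addrC; congr (_ + _).
exact: (reindex_inj rev_ord_inj).
Qed.

Lemma cvg_bounded_by (R : realType) (U : nat -> R) (u : R) :
  U @ \oo --> u -> exists2 K, 0 <= K & forall n, `|U n| <= K.
Proof.
move=> Uu; have [K hK] := cvg_has_ub (cvgP _ Uu).
exists K => [|n]; last by apply: hK; exists n.
by apply: (@le_trans _ _ `|U 0%N|) => //; apply: hK; exists 0%N.
Qed.

(** Passage to the limit in a sum over [-n, n] whose weights U_(n-j) V_(n+j) tend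
    to the constant u v for every fixed j. Both theta identities below are
    obtained from their finite forms in this way. *)
Lemma convolution_cvg (R : realType) (U V : nat -> R) (u v : R)
    (h : int -> R) (C r : R) : 0 < r < 1 -> U @ \oo --> u -> V @ \oo --> v ->
    (forall j : nat, `|h j%:Z| <= C * r ^+ j) ->
    (forall j : nat, `|h (- (j.+1)%:Z)| <= C * r ^+ j) ->
  bilateral_cvg h /\
  (fun n => \sum_(i < (n + n).+1) h (i%:Z - n%:Z) * U (n + n - i)%N * V i)
    @ \oo --> bilateral_sum h * u * v.
Proof.
move=> r01 Uu Vv hp hm.
have [K K0 UK] := cvg_bounded_by Uu.
have [L L0 VL] := cvg_bounded_by Vv.
have bd x a b j : `|x| <= C * r ^+ j -> `|x * U a * V b| <= (C * K * L) * r ^+ j.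
  move=> xC; rewrite !normrM.
  have -> : C * K * L * r ^+ j = (C * r ^+ j) * K * L by ring.
  by rewrite !ler_pM // mulr_ge0.
have subk j : (fun n => (n - j)%N) @ \oo --> \oo by exact: cvg_subnr.
have addk j : (fun n => (n + j)%N) @ \oo --> \oo by exact: cvg_addnr.
have [] := @tannery _ (fun n j => h j%:Z * U (n - j)%N * V (n + j)%N)
  (fun j => h j%:Z * u * v) (C * K * L) r (fun n => n.+1) r01.
- by move=> n; exact: leqnSn.
- by move=> n j _; exact: bd.
- move=> j; apply: cvgM; first (apply: cvgM; first exact: cvg_cst).
    exact: (cvg_comp _ _ (subk j) Uu).
  exact: (cvg_comp _ _ (addk j) Vv).
move=> cp lp.
have [] := @tannery _ (fun n j => h (- (j.+1)%:Z) * U (n + j.+1)%N * V (n - j.+1)%N)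
  (fun j => h (- (j.+1)%:Z) * u * v) (C * K * L) r id r01.
- by [].
- by move=> n j _; exact: bd.
- move=> j; apply: cvgM; first (apply: cvgM; first exact: cvg_cst).
    exact: (cvg_comp _ _ (addk j.+1) Uu).
  exact: (cvg_comp _ _ (subk j.+1) Vv).
move=> cm lm.
have hcvg (g : nat -> R) : (forall j : nat, `|g j| <= C * r ^+ j) -> cvgn (series g).
  move=> gC; apply: normed_cvg.
  apply: (@series_le_cvg _ _ (geometric C r)) => //= [n|].
    exact: le_trans (gC n).
  by apply: is_cvg_geometric_series; have /andP[? ?] := r01; rewrite ger0_norm // ltW.
have cp' := hcvg _ hp; have cm' := hcvg _ hm.
split; first by split.
have limM (g : nat -> R) : cvgn (series g) ->
    limn (series (fun j => g j * u * v)) = limn (series g) * u * v.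
  move=> gc; apply: cvg_lim => //.
  have -> : series (fun j => g j * u * v) = (fun n => series g n * u * v).
    by apply/funext => n; rewrite /series /= !mulr_suml.
  by apply: cvgM; [apply: cvgM => // |]; exact: cvg_cst.
rewrite /bilateral_sum !mulrDl -!limM //.
under eq_cvg => n.
  rewrite (central_sum_split (fun i => h (i%:Z - n%:Z) * U (n + n - i)%N * V i)).
  over.
apply: cvgD.
  apply: cvg_trans lp; apply: near_eq_cvg; near=> n.
  apply: eq_bigr => j _; rewrite subnDl; congr (h _ * _ * _).
  by rewrite PoszD addrAC subrr add0r.
apply: cvg_trans lm; apply: near_eq_cvg; near=> n.
apply: eq_bigr => j _; have jn := ltn_ord j.
congr (h _ * U _ * _); first by lia.
by lia.
Unshelve. all: by end_near.
Qed.

(** * Jacobi's triple product and Kronecker's formula *)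

(** Jacobi's triple product identity. In the finite form the weights
    1 / ((P;P)_(n-j) (P;P)_(n+j)), P = p^2, tend to 1 / (P;P)^2, and the right-hand
    side carries one factor 1 / (P;P)_(2n). The constants C and r only provide a
    geometric majorant for the theta series. *)
Lemma jacobi_triple (R : realType) (p z C r : R) :
    0 < p < 1 -> 0 < r < 1 -> 0 < z ->
    (forall j : nat, p ^+ (j ^ 2) * z ^+ j <= C * r ^+ j) ->
    (forall j : nat, p ^+ (j.+1 ^ 2) / z ^+ j.+1 <= C * r ^+ j) ->
  bilateral_cvg (fun j : int => p ^ (j ^+ 2) * z ^ j) /\
  bilateral_sum (fun j : int => p ^ (j ^+ 2) * z ^ j)
  = qinf (- (z * p)) (p ^+ 2) * qinf (- (p / z)) (p ^+ 2) * qinf (p ^+ 2) (p ^+ 2).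
Proof.
move=> p01 r01 z0 hp hm; have /andP[p0 p1] := p01.
have P01 : 0 < p ^+ 2 < 1 by apply/andP; split; nra.
have /andP[P0 P1] := P01.
have Pk k : (p ^+ 2) ^+ k.+1 != 1.
  by rewrite lt_eqF // exprn_ilt1 // ltW.
have El := cvg_qpoch P1 P01.
have l0 := qinf_gt0 P1 P01.
have ln0 : qinf (p ^+ 2) (p ^+ 2) != 0 by rewrite gt_eqF.
have iE : (fun n => (qpoch (p ^+ 2) (p ^+ 2) n)^-1) @ \oo --> (qinf (p ^+ 2) (p ^+ 2))^-1.
  by apply: cvgV.
set h := fun j : int => _.
have [| |hc hl] := @convolution_cvg _ _ _ _ _ h C r r01 iE iE.
- move=> j; rewrite /h ger0_norm; last by rewrite mulr_ge0 // exprz_ge0 // ltW.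
  exact: hp.
- move=> j; rewrite /h sqrrN ger0_norm; last by rewrite mulr_ge0 // exprz_ge0 // ltW.
  by have := hm j; rewrite -exprnN.
split=> //.
have zp0 : 0 < z * p by rewrite mulr_gt0.
have pz0 : 0 < p / z by rewrite divr_gt0.
have c1 := @cvg_qpoch _ (- (z * p)) (p ^+ 2) _ P01.
have c2 := @cvg_qpoch _ (- (p / z)) (p ^+ 2) _ P01.
have c3 := cvg_comp _ _ cvg_double iE.
have hr : (fun n => \sum_(i < (n + n).+1) h (i%:Z - n%:Z)
      * (qpoch (p ^+ 2) (p ^+ 2) (n + n - i))^-1 * (qpoch (p ^+ 2) (p ^+ 2) i)^-1)
    @ \oo --> qinf (- (z * p)) (p ^+ 2) * qinf (- (p / z)) (p ^+ 2)
      / qinf (p ^+ 2) (p ^+ 2).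
  under eq_cvg do rewrite jacobi_triple_finite ?gt_eqF //.
  by apply: cvgM; [apply: cvgM; [apply: c1 | apply: c2]; lra | exact: c3].
have := cvg_lim (@norm_hausdorff _ _) hl; rewrite (cvg_lim _ hr) // => e.
apply: (mulIf (invr_neq0 ln0)); apply: (mulIf (invr_neq0 ln0)).
by rewrite -e mulfK.
Qed.

(** Kronecker's formula: a Lambert series in x and y is a quotient of theta
    products. Taking y < 0 keeps the denominators 1 - y p^j away from 0; the
    annulus p < x < 1 makes both tails geometric, of ratios x and p / x. *)
Lemma kronecker (R : realType) (p x y : R) : 0 < p < x -> x < 1 -> y < 0 ->
  bilateral_cvg (fun j : int => x ^ j / (1 - y * p ^ j)) /\
  bilateral_sum (fun j : int => x ^ j / (1 - y * p ^ j))
    * (qinf x p * qinf (p / x) p) * (qinf y p * qinf (p / y) p)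
  = qinf (x * y) p * qinf (p / (x * y)) p * qinf p p ^+ 2.
Proof.
move=> /andP[p0 px] x1 y0.
have x0 : 0 < x by exact: lt_trans px.
have p1 : p < 1 by exact: lt_trans x1.
have p01 : 0 < p < 1 by rewrite p0.
have pk k : p ^+ k.+1 != 1 by rewrite lt_eqF // exprn_ilt1 // ltW.
have y1 : y < 1 by exact: lt_trans ltr01.
have pxx : p / x < 1 by rewrite ltr_pdivrMr // mul1r.
have pxx0 : 0 < p / x by rewrite divr_gt0.
have pyy : p / y < 1 by apply: (@lt_trans _ _ 0) => //; rewrite pmulr_rlt0 // invr_lt0.
have xy0 : x * y < 0 by rewrite pmulr_rlt0.
have xy1 : x * y < 1 by exact: lt_trans ltr01.
have pxy : p / (x * y) < 1.
  by apply: (@lt_trans _ _ 0) => //; rewrite pmulr_rlt0 // invr_lt0.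
have yp (j : int) : y * p ^ j < 0 by rewrite nmulr_rlt0 // exprz_gt0.
pose r := Num.max x (p / x).
have r01 : 0 < r < 1 by rewrite /r lt_max x0 /= gt_max x1.
have r0 : 0 < r by case/andP: r01.
have xr : x <= r by rewrite le_max lexx.
have pxr : p / x <= r by rewrite le_max lexx orbT.
set h := fun j : int => _.
have h0 j : 0 <= h j.
  by rewrite /h divr_ge0 ?exprz_ge0 ?ltW // subr_gt0 (lt_trans (yp _)).
have E0 := qinf_gt0 p1 p01.
have En0 : qinf p p != 0 by rewrite gt_eqF.
have cU a : a < 1 -> (fun n => qpoch a p n / qpoch p p n) @ \oo --> qinf a p / qinf p p.
  move=> a1; apply: cvgM; first exact: cvg_qpoch.
  by apply: cvgV => //; exact: cvg_qpoch.
have C1 : 0 <= - y^-1 by rewrite oppr_ge0 invr_le0 ltW.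
have [| |hc hl] := @convolution_cvg _ _ _ _ _ h (1 - y^-1) r r01 (cU _ x1) (cU _ pxx).
- move=> j; rewrite ger0_norm //.
  apply: (@le_trans _ _ (x ^+ j)).
    rewrite /h ler_pdivrMr; last by rewrite subr_gt0 (lt_trans (yp _)).
    by rewrite ler_peMr ?exprn_ge0 ?ltW // ltrDl oppr_gt0.
  apply: (@le_trans _ _ (r ^+ j)).
    by apply: lerXn2r; rewrite ?nnegrE // ltW.
  rewrite ler_peMl ?lerDl // exprn_ge0 // ltW //; by case/andP: r01.
- move=> j; rewrite ger0_norm //.
  apply: (@le_trans _ _ (- y^-1 * (p / x) ^+ j)); last first.
    apply: ler_pM => //; first by rewrite exprn_ge0 // ltW.
      by rewrite lerDr.
    by apply: lerXn2r; rewrite ?nnegrE // ltW.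
  have -> : h (- (j.+1)%:Z) = (p / x) ^+ j.+1 / (p ^+ j.+1 - y).
    have pj0 : p ^+ j.+1 != 0 by rewrite expf_neq0 // gt_eqF.
    have xj0 : x ^+ j.+1 != 0 by rewrite expf_neq0 // gt_eqF.
    have d0 : p ^+ j.+1 - y != 0 by rewrite gt_eqF // subr_gt0 (lt_trans y0) // exprn_gt0.
    rewrite /h -!exprnN exprMn exprVn.
    move: (p ^+ j.+1) (x ^+ j.+1) pj0 xj0 d0 => P X P0 X0 d0.
    field; rewrite P0 X0 d0 //.
  rewrite mulrC; apply: ler_pM.
  + by rewrite invr_ge0 subr_ge0 ltW // (lt_trans y0) // exprn_gt0.
  + by rewrite exprn_ge0 // ltW.
  + rewrite -invrN lef_pV2 ?posrE ?oppr_gt0 //; last first.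
      by rewrite subr_gt0 (lt_trans y0) // exprn_gt0.
    by rewrite lerDr exprn_ge0 // ltW.
  + by rewrite exprS ler_piMl ?exprn_ge0 // ltW.
split=> //.
have Y0 := qinf_gt0 y1 p01; have Y1 := qinf_gt0 pyy p01.
have pn0 : p != 0 by rewrite gt_eqF.
have xn0 : x != 0 by rewrite gt_eqF.
have yn0 : y != 0 by rewrite lt_eqF.
have yp1 j : y * p ^ j != 1 by rewrite lt_eqF // (lt_trans (yp j)).
have hr : (fun n => \sum_(i < (n + n).+1) h (i%:Z - n%:Z)
    * (qpoch x p (n + n - i) / qpoch p p (n + n - i))
    * (qpoch (p / x) p i / qpoch p p i)) @ \oo -->
    qinf (x * y) p * qinf (p / (x * y)) p / (qinf y p * qinf (p / y) p).
  under eq_cvg => n.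
    rewrite (kronecker_finite _ pn0 xn0 yn0 pk yp1).
    over.
  apply: cvgM; first by apply: cvgM; exact: cvg_qpoch.
  apply: cvgV; first by rewrite mulf_neq0 ?gt_eqF.
  apply: cvgM; last exact: cvg_qpoch.
  by have := cvg_qpoch y1 p01; rewrite -cvg_shiftS.
have := cvg_lim (@norm_hausdorff _ _) hl; rewrite (cvg_lim _ hr) // => e.
have Yn0 : qinf y p != 0 by rewrite gt_eqF.
have Yn1 : qinf (p / y) p != 0 by rewrite gt_eqF.
have -> : qinf (x * y) p * qinf (p / (x * y)) p
  = qinf (x * y) p * qinf (p / (x * y)) p / (qinf y p * qinf (p / y) p)
    * (qinf y p * qinf (p / y) p) by rewrite divfK ?mulf_neq0.
by rewrite e; field.
Qed.

(** * The Hecke-type double sum as a Lambert series *)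

Lemma sum_triangle (V : nmodType) (c : nat -> nat -> V) M :
  \sum_(s < M) \sum_(a < s.+1) c a (s - a)%N
  = \sum_(a < M) \sum_(b < M - a) c a b.
Proof.
elim: M => [|M IHM]; first by rewrite !big_ord0.
rewrite big_ord_recr IHM [RHS]big_ord_recr /= subSnn big_ord1 big_ord_recr /=.
rewrite subnn addrA -big_split /=; congr (_ + _).
by apply: eq_bigr => a _; rewrite subSn ?big_ord_recr // ltnW.
Qed.

Lemma alt_geometric_sum (F : fieldType) (A B : F) k : 1 + B != 0 ->
  \sum_(b < k) (-1) ^+ b * (A * B ^+ b) = A / (1 + B) * (1 - (- B) ^+ k).
Proof.
move=> B0; have := subrXX 1 (- B) k; rewrite expr1n opprK => ->.
rewrite mulrA divfK // mulr_sumr.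
by apply: eq_bigr => b _; rewrite expr1n mul1r [in RHS]exprNn mulrCA.
Qed.

(** The Hecke-type double sum in the coordinates a = n - j, b = n + j, with
    q = t^2: the two powers of t come from 1 and q^(2n+1) in the factor
    1 + q^(2n+1), and 2n^2 - 2j^2 = 2ab. The coordinates range over all a and b,
    although only a + b even corresponds to integers n and j. *)
Definition hecke_term (R : pzRingType) (t : R) (a b : nat) : R :=
  (-1) ^+ b * (t ^+ (a + b + 4 * a * b) + t ^+ (3 * a + 3 * b + 4 * a * b + 2)).

Definition lambert_term (R : realType) (t : R) (j : int) : R :=
  t ^ j / (1 - (- t) * (t ^+ 4) ^ j).

Lemma lambert_term_pos (R : realType) (t : R) (a : nat) :
  lambert_term t a%:Z = t ^+ a / (1 + t ^+ (4 * a + 1)).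
Proof. by rewrite /lambert_term mulNr opprK -!exprnP -exprM addn1 exprS. Qed.

Lemma lambert_term_neg (R : realType) (t : R) (a : nat) : 0 < t ->
  lambert_term t (- (a.+1)%:Z) = t ^+ (3 * a + 2) / (1 + t ^+ (4 * a + 3)).
Proof.
move=> t0; have tk k : t ^+ k != 0 by rewrite expf_neq0 // gt_eqF.
have d0 k : 1 + t ^+ k != 0 by rewrite gt_eqF // addr_gt0 // exprn_gt0.
rewrite /lambert_term mulNr opprK -!exprnN -exprM.
have e1 : t ^+ (4 * a.+1) = t ^+ (4 * a + 3) * t by rewrite -exprSr; congr (_ ^+ _); lia.
have e2 : t ^+ (4 * a + 3) = t ^+ (3 * a + 2) * t ^+ a.+1.
  by rewrite -exprD; congr (_ ^+ _); lia.
have d1 : 1 + t / t ^+ (4 * a.+1) != 0.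
  by rewrite gt_eqF // addr_gt0 // divr_gt0 // exprn_gt0.
rewrite e1; have h := d0 (4 * a + 3)%N; have h1 := tk a.+1.
have h2 := tk (3 * a + 2)%N; move: h; rewrite e2 => h.
have t1 : t != 0 by rewrite gt_eqF.
move: (t ^+ (3 * a + 2)) (t ^+ a.+1) h1 h2 h => X Y Y0 X0 h.
by field; rewrite ?X0 ?Y0 ?t1 ?h // addrC.
Qed.

(** Each row is a pair of geometric series; their sums are the terms of index a
    and - (a + 1) of one bilateral Lambert series. *)
Lemma hecke_row (R : realType) (t : R) a k : 0 < t ->
  \sum_(b < k) hecke_term t a b
  = lambert_term t a%:Z * (1 - (- t ^+ (4 * a + 1)) ^+ k)
    + lambert_term t (- (a.+1)%:Z) * (1 - (- t ^+ (4 * a + 3)) ^+ k).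
Proof.
move=> t0; rewrite lambert_term_pos lambert_term_neg //.
have d0 m : 1 + t ^+ m != 0 by rewrite gt_eqF // addr_gt0 // exprn_gt0.
rewrite -!alt_geometric_sum // -big_split; apply: eq_bigr => b _ /=.
rewrite /hecke_term -!exprM -!exprD mulrDr.
by congr (_ * _ ^+ _ + _ * _ ^+ _); lia.
Qed.

(** The triangles a + b < M exhaust the quadrant, and the truncated rows are
    dominated by a geometric series in a, so the limit may be taken row by row. *)
Lemma hecke_triangle_cvg (R : realType) (t : R) : 0 < t < 1 ->
  cvgn (series (fun a => lambert_term t a%:Z + lambert_term t (- (a.+1)%:Z))) /\
  (fun M => \sum_(a < M) \sum_(b < M - a) hecke_term t a b) @ \oo
  --> limn (series (fun a => lambert_term t a%:Z + lambert_term t (- (a.+1)%:Z))).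
Proof.
move=> t01; have /andP[t0 t1] := t01.
have tk k : 0 <= t ^+ k <= 1 by rewrite exprn_ge0 ?exprn_ile1 ?ltW.
have bound (A B : R) k : 0 <= A -> 0 <= B <= 1 -> `|A / (1 + B) * (1 - (- B) ^+ k)| <= 2 * A.
  move=> A0 /andP[B0 B1]; rewrite normrM mulrC; apply: ler_pM => //.
    apply: (le_trans (ler_normB _ _)); rewrite normr1 normrX normrN.
    by rewrite lerD2l exprn_ile1 // ger0_norm.
  rewrite ger0_norm; last by rewrite divr_ge0 // addr_ge0.
  by rewrite ler_pdivrMr ?ltr_pwDl // ler_peMr // lerDl.
have gcvg (B : R) a : 0 <= B < 1 -> (fun n => (- B) ^+ (n - a)) @ \oo --> (0 : R).
  move=> /andP[B0 B1]; apply: (cvg_comp _ _ (cvg_subnr a)).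
  by apply: cvg_expr; rewrite normrN ger0_norm.
apply: (@tannery _ (fun M a => \sum_(b < M - a) hecke_term t a b) _ 4 t id) => //.
- move=> M a _; rewrite hecke_row // lambert_term_pos lambert_term_neg //.
  apply: (le_trans (ler_normD _ _)).
  have h1 := bound _ _ (M - a)%N (andP (tk a)).1 (tk (4 * a + 1)%N).
  have h2 := bound _ _ (M - a)%N (andP (tk (3 * a + 2)%N)).1 (tk (4 * a + 3)%N).
  apply: (le_trans (lerD h1 h2)).
  have : t ^+ (3 * a + 2) <= t ^+ a by apply: ler_wiXn2l; [exact: ltW | exact: ltW | lia].
  lra.
- move=> a; under eq_cvg do rewrite hecke_row //.
  have -> : lambert_term t a%:Z + lambert_term t (- (a.+1)%:Z)
    = lambert_term t a%:Z * (1 - 0) + lambert_term t (- (a.+1)%:Z) * (1 - 0).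
    by rewrite subr0 !mulr1.
  apply: cvgD; apply: cvgM; try exact: cvg_cst.
    apply: cvgB; first exact: cvg_cst.
    by apply: gcvg; rewrite exprn_ge0 ?ltW //= exprn_ilt1 ?ltW // addn1.
  apply: cvgB; first exact: cvg_cst.
  by apply: gcvg; rewrite exprn_ge0 ?ltW //= exprn_ilt1 ?ltW // addn3.
Qed.

Lemma hecke_odd_diagonal (R : numDomainType) (t : R) n :
  \sum_(a < (n + n).+2) hecke_term t a ((n + n).+1 - a) = 0.
Proof.
have odd2 : odd (n + n) = false by rewrite addnn odd_double.
set S := \sum_(a < _) _.
(* Swapping a and b fixes the powers of t; as a + b is odd, it flips the sign. *)
have /eqP : S = - S.
  rewrite {1}/S (reindex_inj rev_ord_inj) /= -sumrN; apply: eq_bigr => a _.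
  have an : (a <= (n + n).+1)%N by rewrite -ltnS.
  rewrite subSS subKn // /hecke_term -mulNr; congr (_ * (_ ^+ _ + _ ^+ _)); try lia.
  rewrite -signr_odd -[in RHS]signr_odd oddB //= odd2 /=.
  by case: (odd a); rewrite ?expr0 ?expr1 ?opprK.
by rewrite -addr_eq0 -mulr2n mulrn_eq0 => /eqP.
Qed.

Lemma fsum_centered (R : nmodType) (g : int -> R) n :
  \sum_(j \in `[- n%:Z, n%:Z]) g j = \sum_(i < (n + n).+1) g (i%:Z - n%:Z).
Proof.
rewrite (fsbig_ord _ _ (fun i : nat => g (i%:Z - n%:Z))).
apply: reindex_fsbig; split.
- by move=> i /= i2n; rewrite in_itv /=; lia.
- by move=> i j _ _ /=; lia.
- move=> j /=; rewrite in_itv /= => jn; exists (absz (j + n%:Z)) => /=; lia.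
Qed.

Lemma hecke_even_diagonal (R : realType) (t : R) n : 0 < t ->
  \sum_(a < (n + n).+1) hecke_term t a (n + n - a) = inner_sum (t ^+ 2) n.
Proof.
move=> t0; have t1 : t != 0 by rewrite gt_eqF.
rewrite /inner_sum fsum_centered (reindex_inj rev_ord_inj) /=.
apply: eq_bigr => i _.
have ni : (i <= n + n)%N by rewrite -ltnS.
have -> : n%:Z + (i%:Z - n%:Z) = i%:Z by rewrite addrC subrK.
rewrite subSS subKn // /hecke_term -mulrA; congr (_ * _).
have -> : 2 * n%:Z ^+ 2 + n%:Z - 2 * (i%:Z - n%:Z) ^+ 2
  = (n + 2 * i * (n + n - i))%N%:Z.
  rewrite !PoszD !PoszM -subzn // !PoszD; ring.
rewrite -exprnP -!exprM mulrDl mul1r -!exprD.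
by congr (_ ^+ _ + _ ^+ _); lia.
Qed.

Lemma inner_sum_series (R : realType) (t : R) N : 0 < t ->
  series (inner_sum (t ^+ 2)) N
  = \sum_(a < N + N) \sum_(b < N + N - a) hecke_term t a b.
Proof.
move=> t0; rewrite -sum_triangle; elim: N => [|N IHN].
  by rewrite /series /= big_nil big_ord0.
rewrite seriesSr IHN addSn addnS [RHS]big_ord_recr /= hecke_odd_diagonal addr0.
by rewrite [RHS]big_ord_recr /= hecke_even_diagonal.
Qed.

(** The first N inner sums fill the triangle a + b < 2N, the odd antidiagonals
    contributing nothing. *)
Lemma inner_sum_lambert (R : realType) (t : R) : 0 < t < 1 ->
  bilateral_cvg (lambert_term t) ->
  series (inner_sum (t ^+ 2)) @ \oo --> bilateral_sum (lambert_term t).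
Proof.
move=> t01 [cp cm]; have [_ lM] := hecke_triangle_cvg t01.
rewrite /bilateral_sum -lim_seriesD //.
have -> : series (inner_sum (t ^+ 2)) = fun N =>
    \sum_(a < N + N) \sum_(b < N + N - a) hecke_term t a b.
  by apply/funext => N; rewrite inner_sum_series //; case/andP: t01.
exact: (cvg_comp _ _ cvg_double lM).
Qed.

(** * The product side *)

(** Kronecker's formula at x = t, y = - t, p = t^4. The four products in the
    denominator pair up by (a;p)(-a;p) = (a^2;p^2), and the resulting (q;q^4) and
    (q^3;q^4) are the two halves of (q;q^2), where q = t^2. *)
Lemma lambert_product (R : realType) (t : R) : 0 < t < 1 ->
  bilateral_cvg (lambert_term t) /\
  bilateral_sum (lambert_term t) * qinf (t ^+ 2) (t ^+ 4)
  = qinf (- t ^+ 2) (t ^+ 4) ^+ 2 * qinf (t ^+ 4) (t ^+ 4) ^+ 2.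
Proof.
move=> /andP[t0 t1].
have t0' : t != 0 by rewrite gt_eqF.
have tk k : 0 < t ^+ k.+1 < 1 by rewrite exprn_gt0 // exprn_ilt1 // ltW.
have [|//||hc hs] := @kronecker R (t ^+ 4) t (- t).
- by rewrite exprn_gt0 //= exprS gtr_pMr //; case/andP: (tk 2).
- by rewrite oppr_lt0.
split=> //; move: hs; rewrite -/(lambert_term t).
have -> : t ^+ 4 / t = t ^+ 3 by field.
have -> : t ^+ 4 / - t = - t ^+ 3 by field.
have -> : t * - t = - t ^+ 2 by ring.
have -> : t ^+ 4 / - t ^+ 2 = - t ^+ 2 by field.
move=> hs; rewrite -expr2 in hs; rewrite -hs -mulrA; congr (_ * _).
have m1 (x : R) : 0 < x < 1 -> -1 < x < 1 by lra.
have t4 := tk 3.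
rewrite mulrACA !qinf_oppM ?m1 ?(tk 2) ?t0 ?t1 //.
rewrite (qinf_double (p := t ^+ 4)) //.
- by rewrite -!exprM -exprD.
- by case/andP: (tk 1).
- by rewrite -exprD; case/andP: (tk 5).
Qed.

(** The triple product at z = 1. *)
Lemma phi_product (R : realType) (q : R) : 0 < q < 1 ->
  bilateral_cvg (fun n : int => q ^ (n ^+ 2)) /\
  bilateral_sum (fun n : int => q ^ (n ^+ 2))
  = qinf (- q) (q ^+ 2) ^+ 2 * qinf (q ^+ 2) (q ^+ 2).
Proof.
move=> q01; have /andP[q0 q1] := q01.
have := @jacobi_triple R q 1 1 q q01 q01 ltr01.
have -> : (fun j : int => q ^ (j ^+ 2) * 1 ^ j) = (fun n : int => q ^ (n ^+ 2)).
  by apply/funext => j; rewrite exp1rz mulr1.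
rewrite mul1r divr1 -expr2; apply.
- move=> j; rewrite expr1n mulr1 mul1r; apply: ler_wiXn2l; [exact: ltW | exact: ltW | nia].
- move=> j; rewrite expr1n divr1 mul1r; apply: ler_wiXn2l; [exact: ltW | exact: ltW | nia].
Qed.

(** The triple product at p = z = t, so that p^(j^2) z^j = q^(j(j+1)/2) for
    q = t^2. *)
Lemma psi_product (R : realType) (t : R) : 0 < t < 1 ->
  let q := t ^+ 2 in
  cvgn (series (fun n : nat => q ^+ ((n * (n + 1)) %/ 2))) /\
  limn (series (fun n : nat => q ^+ ((n * (n + 1)) %/ 2)))
  = qinf (- q) q ^+ 2 * qinf q q.
Proof.
move=> t01 q; have /andP[t0 t1] := t01.
have t0' : t != 0 by rewrite gt_eqF.
have q01 : 0 < q < 1 by rewrite exprn_gt0 // exprn_ilt1 // ltW.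
have e n : q ^+ ((n * (n + 1)) %/ 2) = t ^+ (n ^ 2) * t ^+ n.
  rewrite -exprM -exprD; congr (_ ^+ _).
  rewrite mulnC divnK; first by lia.
  by rewrite dvdn2 oddM addn1 /=; case: (odd n).
have [||[cp _] hs] := @jacobi_triple R t t 1 t t01 t01 t0.
- move=> j; rewrite mul1r ler_piMl ?exprn_ge0 ?exprn_ile1 // ltW //.
- move=> j; rewrite mul1r -exprB ?unitfE //; last by lia.
  by apply: ler_wiXn2l; [exact: ltW | exact: ltW | nia].
(* The terms of index n and - (n + 1) agree, so the bilateral sum is twice psi. *)
have fp : (fun n : nat => t ^ (n%:Z ^+ 2) * t ^ n%:Z)
    = (fun n : nat => q ^+ ((n * (n + 1)) %/ 2)).
  by apply/funext => n; rewrite e.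
have fm : (fun n : nat => t ^ ((- (n.+1)%:Z) ^+ 2) * t ^ (- (n.+1)%:Z))
    = (fun n : nat => q ^+ ((n * (n + 1)) %/ 2)).
  apply/funext => n; rewrite e -expfzDr // -exprD [RHS]exprnP; congr (t ^ _).
  lia.
rewrite fp in cp; split=> //; move: hs; rewrite /bilateral_sum fp fm.
rewrite divff // -expr2 -/q.
have -> : qinf (-1) q = 2 * qinf (- q) q.
  have c := @cvg_qpoch _ (- q) q _ q01.
  apply: cvg_lim => //; rewrite -cvg_shiftS /=.
  under eq_cvg do rewrite qpochSl mulN1r opprK.
  by apply: cvgM; [exact: cvg_cst | apply: c; lra].
set a := limn _ => h.
suff : 2 * a = 2 * (qinf (- q) q ^+ 2 * qinf q q) by lra.
by rewrite mulrDl mul1r h; ring.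
Qed.

Theorem mainTheorem12 (R : realType) (q : R) (hq0 : 0 < q) (hq1 : q < 1) :
  [/\ bilateral_cvg (fun n : int => q ^ (n ^+ 2)),
      cvgn (series (fun n : nat => q ^+ ((n * (n + 1)) %/ 2))),
      cvgn (series (inner_sum q))
    & bilateral_sum (fun n : int => q ^ (n ^+ 2))
        * limn (series (fun n : nat => q ^+ ((n * (n + 1)) %/ 2)))
      = limn (series (inner_sum q))].
Proof.
have q01 : 0 < q < 1 by rewrite hq0.
pose t := Num.sqrt q.
have tq : t ^+ 2 = q by rewrite sqr_sqrtr // ltW.
have t0 : 0 < t by rewrite sqrtr_gt0.
have t01 : 0 < t < 1 by rewrite t0 /=; nra.
have q2 : 0 < q ^+ 2 < 1 by apply/andP; split; nra.
have [phi_cvg phiE] := phi_product q01.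
have := psi_product t01; rewrite tq => -[psi_cvg psiE].
have [lc] := lambert_product t01.
have -> : t ^+ 4 = q ^+ 2 by rewrite -tq -exprM.
rewrite tq => lE.
have := inner_sum_lambert t01 lc; rewrite tq => sl.
split=> //; first exact: cvgP sl.
rewrite (cvg_lim _ sl) // phiE psiE.
have Q0 : 0 < qinf q (q ^+ 2) by exact: qinf_gt0.
apply: (mulIf (lt0r_neq0 Q0)); rewrite lE.
have m1 : -1 < q < 1 by lra.
rewrite -(qinf_oppM m1 q01).
have euler : qinf q (q ^+ 2) * (qinf q q * qinf (- q) q) = qinf q q.
  by rewrite (qinf_oppM m1 q01) [RHS]qinf_double // -expr2; nra.
transitivity (qinf (- q) (q ^+ 2) ^+ 2 * qinf q q * qinf (- q) q ^+ 2
  * (qinf q (q ^+ 2) * (qinf q q * qinf (- q) q))); first by ring.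
by rewrite euler; ring.
Qed.
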